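(* Let $P$ be a single while loop $\textbf{while}~\phi~\textbf{do}~Q~\textbf{od}$ over integer program variables $x_1,\dots,x_{|X|}$ and integer sampling variables $r_1,\dots,r_{|R|}$, with sampling function $\Upsilon$ and loop-body function $F:\mathbb{Z}^{|X|}\times\mathbb{Z}^{|R|}\to\mathbb{Z}^{|X|}$ (as described in the context). Suppose there exists a difference-bounded supermartingale map $h$ for $P$. Then for every initial program valuation $\mathbf{v}_0\in\mathbb{Z}^{|X|}$, the termination time $T$ of $P$ started from $(\mathtt{in},\mathbf{v}_0)$ satisfies $\mathbb{P}(T<\infty)=1$, and the function $k\mapsto\mathbb{P}(T\ge k)$ belongs to $\mathcal{O}\left(\frac{1}{\sqrt{k}}\right)$.
   Context: Setting. $\phi$ is a Boolean predicate over the program variables and $Q$ is a loop-free program (assignments, conditionals, sequential composition) whose effect is given by a function $F:\mathbb{Z}^{|X|}\times\mathbb{Z}^{|R|}\to\mathbb{Z}^{|X|}$ mapping the program valuation $\mathbf{v}$ before the loop body and the sampled values $\mathbf{u}$ to the valuation $F(\mathbf{v},\mathbf{u})$ after the body. Write $\mathbf{v}\models\phi$ if valuation $\mathbf{v}$ satisfies $\phi$. A sampling function $\Upsilon$ assigns to each sampling variable $r_i$ a discrete probability distribution $\Upsilon(r_i)$ on $\mathbb{Z}$; the joint distribution is $\bar{\Upsilon}(\mathbf{u}):=\prod_{i=1}^{|R|}\Upsilon(r_i)(\mathbf{u}[i])$ on $\mathbb{Z}^{|R|}$, with support $\mathrm{supp}\,\bar{\Upsilon}=\{\mathbf{u}\mid\bar{\Upsilon}(\mathbf{u})>0\}$.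 Semantics: a Markov chain on configurations $\{\mathtt{in},\mathtt{out}\}\times\mathbb{Z}^{|X|}$ with transition probabilities: $\mathbf{P}((\mathtt{in},\mathbf{v}),(\mathtt{in},\mathbf{v}'))=\sum_{\mathbf{u}:\,F(\mathbf{v},\mathbf{u})=\mathbf{v}'}\bar{\Upsilon}(\mathbf{u})$ if $\mathbf{v}\models\phi$; $\mathbf{P}((\mathtt{in},\mathbf{v}),(\mathtt{out},\mathbf{v}))=1$ if $\mathbf{v}\not\models\phi$; $\mathbf{P}((\mathtt{out},\mathbf{v}),(\mathtt{out},\mathbf{v}))=1$; all other transitions have probability $0$ (so sampled values are drawn independently at each iteration). Starting from $(\mathtt{in},\mathbf{v}_0)$ this yields a random path $\{(\ell_n,\mathbf{v}_n)\}_{n\ge0}$ and probability measure $\mathbb{P}$; the termination time is $T:=\min\{n\mid \ell_n=\mathtt{out}\}$ (with $\min\emptyset=\infty$). Definition. A difference-bounded supermartingale map for $P$ is a function $h:\{\mathtt{in},\mathtt{out}\}\times\mathbb{Z}^{|X|}\to\mathbb{R}$ for which there exist reals $\delta,\zeta>0$ such that for all configurations $(\ell,\mathbf{v})$: (D1) if $\ell=\mathtt{out}$ then $h(\ell,\mathbf{v})=0$; (D2) if $\ell=\mathtt{in}$ and $\mathbf{v}\models\phi$ then $h(\ell,\mathbf{v})\ge\delta$ and $h(\ell,F(\mathbf{v},\mathbf{u}))\ge\delta$ for all $\mathbf{u}\in\mathrm{supp}\,\bar{\Upsilon}$; (D3) if $\ell=\mathtt{in}$ and $\mathbf{v}\models\phi$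 then $\sum_{\mathbf{u}\in\mathbb{Z}^{|R|}}\bar{\Upsilon}(\mathbf{u})\,h(\ell,F(\mathbf{v},\mathbf{u}))\le h(\ell,\mathbf{v})$ and $\sum_{\mathbf{u}\in\mathbb{Z}^{|R|}}\bar{\Upsilon}(\mathbf{u})\,|g(\ell,\mathbf{v},\mathbf{u})|\ge\delta$, where $g(\ell,\mathbf{v},\mathbf{u}):=h(\ell,F(\mathbf{v},\mathbf{u}))-h(\ell,\mathbf{v})$; (D4) $|g(\mathtt{in},\mathbf{v},\mathbf{u})|\le\zeta$ for all $\mathbf{u}\in\mathrm{supp}\,\bar{\Upsilon}$ and all $\mathbf{v}$ with $\mathbf{v}\models\phi$, and $h(\mathtt{in},F(\mathbf{v},\mathbf{u}))\le\zeta$ for all $\mathbf{v},\mathbf{u}\in\mathrm{supp}\,\bar{\Upsilon}$ with $\mathbf{v}\models\phi$ and $F(\mathbf{v},\mathbf{u})\not\models\phi$. *)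

(* Defs.v *)
From HB Require Import structures.
From mathcomp Require Import all_boot all_order all_algebra.
From mathcomp Require Import all_classical all_reals all_analysis.
Import Order.TTheory GRing.Theory Num.Theory.
Import numFieldNormedType.Exports.

Set Implicit Arguments.
Unset Strict Implicit.
Unset Printing Implicit Defensive.

Local Open Scope classical_set_scope.
Local Open Scope ring_scope.

Definition valuation (n : nat) := {ffun 'I_n -> int}.

Record distribution (R : realType) := Distribution {
  pmf :> int -> R;
  pmf_ge0 : forall z, 0 <= pmf z;
  pmf_sum1 : \esum_(z in [set: int]) (pmf z)%:E = 1%E }.

(* The loop "while guard do Q od", with [nx] program variables and [nr]
   sampling variables; the loop-free body Q is represented by its effect: the
   valuation before the body and the sampled values determine the valuation
   after it. *)
Record while_loop (R : realType) (nx nr : nat) := WhileLoop {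
  guard : pred (valuation nx);
  body : valuation nx -> valuation nr -> valuation nx;
  sampling : 'I_nr -> distribution R }.

Section Loop.
Variables (R : realType) (nx nr : nat) (L : while_loop R nx nr).

Definition joint (u : valuation nr) : R := \prod_(i < nr) sampling L i (u i).

Definition supp_joint : set (valuation nr) := [set u | 0 < joint u].

Inductive location := loc_in | loc_out.

Definition config := (location * valuation nx)%type.

Definition transition (c c' : config) : \bar R :=
  match c, c' with
  | (loc_in, v), (loc_in, v') =>
      if guard L v then \esum_(u in [set u | body L v u = v']) (joint u)%:E
      else 0%E
  | (loc_in, v), (loc_out, v') =>
      if guard L v then 0%E else (if v' == v then 1%E else 0%E)
  | (loc_out, _), (loc_in, _) => 0%E
  | (loc_out, v), (loc_out, v') => if v' == v then 1%E else 0%E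
  end.

(* [Z] is a realization on the probability space (Omega, P) of the Markov chain
   with transition matrix [transition] and initial configuration (in, v0): the
   finite-dimensional distributions determine the law of the random path. As
   configurations are countable, the first clause says that each [Z k] is a
   random variable. *)
Definition loop_process d (Omega : measurableType d) (P : probability Omega R)
    (v0 : valuation nx) (Z : nat -> Omega -> config) : Prop :=
  [/\ forall k c, measurable [set w | Z k w = c],
      P [set w | Z 0%N w = (loc_in, v0)] = 1%E &
      forall (k : nat) (c : nat -> config), c 0%N = (loc_in, v0) ->
        P [set w | forall i, (i <= k)%N -> Z i w = c i] =
        (\prod_(i < k) transition (c i) (c i.+1))%E].

(* The infimum is a minimum, except that [ereal_inf set0 = +oo]. *)
Definition termination_time (Omega : Type) (Z : nat -> Omega -> config)
    (w : Omega) : \bar R :=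
  ereal_inf [set k%:R%:E | k in [set k : nat | (Z k w).1 = loc_out]].

Definition increment (h : config -> R) (v : valuation nx) (u : valuation nr) : R :=
  h (loc_in, body L v u) - h (loc_in, v).

(* [\esum] is the sum of a family of nonnegative terms: in the first sum below
   the terms are nonnegative by the clause that precedes it (they vanish
   outside [supp_joint]). *)
Definition dbsm_map (h : config -> R) : Prop :=
  exists delta zeta : R, [/\ 0 < delta, 0 < zeta &
  [/\ forall v, h (loc_out, v) = 0,
      forall v, guard L v ->
        delta <= h (loc_in, v) /\
        forall u, supp_joint u -> delta <= h (loc_in, body L v u),
      forall v, guard L v ->
        (\esum_(u in [set: valuation nr]) (joint u * h (loc_in, body L v u))%:E
           <= (h (loc_in, v))%:E)%E /\
        (delta%:E
           <= \esum_(u in [set: valuation nr]) (joint u * `|increment h v u|)%:E)%E &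
      (forall v u, supp_joint u -> guard L v -> `|increment h v u| <= zeta) /\
      (forall v u, supp_joint u -> guard L v -> ~~ guard L (body L v u) ->
         h (loc_in, body L v u) <= zeta)]].

End Loop.

(* Main.v *)
(* With t > 0 small, e^(-t h) is a submartingale inside the loop, and it grows
   in expectation by a factor at least 1 + q, q = t^2 delta^2 / 4: the drift of h
   has the right sign, and the second-order term of e^(-y) >= (1 - y/2)^2 picks
   up the variance, which is at least delta^2.  Iterating n times, the
   probability p_n of making n further steps inside the loop satisfies
   p_n (1 - (1 + q)^-n) <= 1 - e^(-t h(v0)) <= t h(v0).  Taking t = 2 / (zeta sqrt n)
   keeps (1 + q)^n >= 1 + (delta / zeta)^2 and yields p_n = O(1 / sqrt n). *)
Require Import Defs.
From HB Require Import structures.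
From mathcomp Require Import all_boot all_order all_algebra.
From mathcomp Require Import all_classical all_reals all_analysis.
From mathcomp Require Import ring lra.
Import Order.TTheory GRing.Theory Num.Theory.
Import numFieldNormedType.Exports.

Set Implicit Arguments.
Unset Strict Implicit.
Unset Printing Implicit Defensive.

Local Open Scope classical_set_scope.
Local Open Scope ring_scope.

(** * Unordered sums and countable additivity *)

Lemma esumZl (R : realType) (T : choiceType) (I : set T) (a : R)
    (f : T -> \bar R) :
  0 <= a -> (forall i, 0 <= f i)%E ->
  (\esum_(i in I) (a%:E * f i) = a%:E * \esum_(i in I) f i)%E.
Proof.
move=> a0 f0; rewrite /esum -ereal_supZl//; last first.
  apply/set0P; exists (\sum_(i \in set0) f i)%E.
  by exists set0 => //; exact: fsets_set0.
congr ereal_sup; apply/seteqP; split => x /=.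
  move=> [X XI <-]; exists (\sum_(i \in X) f i)%E; first by exists X.
  by rewrite ge0_mule_fsumr.
by move=> [_ [X XI <-] <-]; exists X => //; rewrite ge0_mule_fsumr.
Qed.

(** Countable additivity over sets of naturals is transported along the injection [pickle], and the
    resulting series is pulled back to [I]. *)
Lemma measure_bigcup_count (R : realType) (d : measure_display)
    (Omega : measurableType d) (mu : {measure set Omega -> \bar R})
    (I : countType) (E : I -> set Omega) :
  (forall i, measurable (E i)) -> trivIset setT E ->
  mu (\bigcup_i E i) = \esum_(i in [set: I]) mu (E i).
Proof.
move=> mE tE.
pose F n := if unpickle n is Some i then E i else set0.
have FE i : F (pickle i) = E i by rewrite /F pickleK.
have -> : \bigcup_i E i = \bigcup_(n in range (@pickle I)) F n.
  apply/seteqP; split => x.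
    by move=> [i _ Ei]; exists (pickle i); rewrite ?FE//; exists i.
  by move=> [_ [i _ <-]]; rewrite FE => Ei; exists i.
rewrite measure_bigcup//.
- rewrite nneseries_esum; last by [].
  rewrite (_ : [set x | x \in range (@pickle I)] = range (@pickle I)); last first.
    by apply/seteqP; split => x /=; rewrite inE.
  rewrite esum_image; last by move=> i j _ _; exact: (pcan_inj pickleK).
  by apply: eq_esum => i _; rewrite FE.
- by move=> _ [i _ <-]; rewrite FE.
- move=> _ _ [i _ <-] [j _ <-]; rewrite !FE => /tE.
  by move=> ->.
Qed.

(** * Elementary real inequalities *)

(** With [x] and [y] the values of [h] before and after the body and D = t (y - x), this is e^(-D)
    >= 1 - D + D^2 / 4, where D^2 is traded for |D| because only the mean of |y - x| is bounded
    below. For nonnegative [x], [y] and [delta] every summand on either side is nonnegative, so the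
    inequality can be summed with [\esum]. *)
Lemma supermartingale_step (R : realType) (delta zeta t x y : R) :
  0 < t -> t * zeta <= 2 -> `|y - x| <= zeta ->
  let E := expR (- (t * x)) in
  (1 - expR (- (t * y))) + (E * (t ^+ 2 * delta / 2) * `|y - x| + E * (t * x))
  <= (1 - E) + (E * t * y + E * (t ^+ 2 * delta ^+ 2 / 4)).
Proof.
move=> t0 tz dxy /=.
set E := expR (- (t * x)).
have E0 : 0 < E by exact: expR_gt0.
have -> : expR (- (t * y)) = E * expR (- (t * (y - x))).
  by rewrite -expRD; congr expR; ring.
set D := t * (y - x).
have DE : `|D| = t * `|y - x| by rewrite normrM gtr0_norm.
have D2 : D <= 2.
  rewrite (le_trans (ler_norm _))// DE (le_trans _ tz)//.
  by rewrite ler_pM2l.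
(* Squaring 1 - D / 2 <= e^(-D / 2) is legitimate because [D <= 2]. *)
have H : (1 - D / 2) ^+ 2 <= expR (- D).
  rewrite (_ : - D = (- D / 2) + (- D / 2)); last by field.
  rewrite expRD -expr2 ler_pXn2r ?nnegrE ?expR_ge0//; last lra.
  by have := expR_ge1Dx (- D / 2); lra.
have D3 : `|D| ^+ 2 = D ^+ 2 by rewrite real_normK ?num_real.
(* This is (|D| - t delta)^2 >= 0 divided by 4: the square is replaced by its tangent at t delta. *)
have H2 : t ^+ 2 * delta / 2 * `|y - x| - t ^+ 2 * delta ^+ 2 / 4 <= D ^+ 2 / 4.
  have -> : t ^+ 2 * delta / 2 * `|y - x| = t * delta / 2 * `|D|.
    by rewrite DE; field.
  have := sqr_ge0 (`|D| - t * delta); rewrite -D3; nra.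
have H3 : t ^+ 2 * delta / 2 * `|y - x| - t * (y - x) - t ^+ 2 * delta ^+ 2 / 4
          <= expR (- D) - 1.
  have -> : t * (y - x) = D by [].
  nra.
have := ler_wpM2l (ltW E0) H3.
move: (expR (- D)) => e; lra.
Qed.

Lemma bernoulli_ge (R : realDomainType) (q : R) (n : nat) :
  0 <= q -> 1 + q *+ n <= (1 + q) ^+ n.
Proof.
move=> q0; elim: n => [|n IHn]; first by rewrite mulr0n addr0 expr0.
by rewrite exprS mulrS; have := mulrn_wge0 n q0; nra.
Qed.

(** * Transition probabilities and the drift of the potential *)

Lemma joint_ge0 (R : realType) (nx nr : nat) (L : while_loop R nx nr)
    (u : valuation nr) : 0 <= joint L u.
Proof. by apply: prodr_ge0 => i _; exact: Defs.pmf_ge0. Qed.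

Lemma transition_ge0 (R : realType) (nx nr : nat) (L : while_loop R nx nr)
    (c c' : config nx) : (0 <= transition L c c')%E.
Proof.
case: c c' => [[] v] [[] v'] //=.
- case: ifP => // _; apply: esum_ge0 => u _.
  by rewrite lee_fin joint_ge0.
- by case: ifP => // _; case: ifP.
- by case: ifP.
Qed.

(** The fibres of [body L v] partition the sampled values, so an expectation over successor
    valuations becomes one over samples. *)
Lemma esum_transition (R : realType) (nx nr : nat) (L : while_loop R nx nr)
    (v : valuation nx) (f : valuation nx -> R) :
  guard L v -> (forall v', 0 <= f v') ->
  (\esum_(v' in [set: valuation nx])
     (transition L (loc_in, v) (loc_in, v') * (f v')%:E) =
   \esum_(u in [set: valuation nr]) (joint L u * f (body L v u))%:E)%E.
Proof.
move=> gv f0 /=; rewrite gv.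
transitivity (\esum_(v' in [set: valuation nx])
    \esum_(u in [set u | body L v u = v']) (joint L u * f v')%:E)%E.
  apply: eq_esum => v' _; rewrite muleC -esumZl//.
    by apply: eq_esum => u _; rewrite -EFinM mulrC.
  by move=> u; rewrite lee_fin joint_ge0.
rewrite esum_esum; last by move=> v' u _ _; rewrite lee_fin mulr_ge0 ?joint_ge0.
rewrite (@reindex_esum _ _ _ [set: valuation nr] _ (fun u => (body L v u, u)))//.
split.
- by move=> u _; split.
- by move=> u u' _ _ [].
- by move=> [v' u] [_ /= <-]; exists u.
Qed.

(* h is unconstrained at unreachable valuations; the maximum keeps the potential
   nonnegative there. *)
Definition potential (R : realType) (nx : nat) (h : config nx -> R) (t : R)
    (v : valuation nx) : R :=
  1 - expR (- (t * Num.max 0 (h (loc_in, v)))).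

Lemma potential_ge0 (R : realType) (nx : nat) (h : config nx -> R) (t : R)
    (v : valuation nx) : 0 <= t -> 0 <= potential h t v.
Proof.
by move=> t0; rewrite subr_ge0 -expR0 ler_expR oppr_le0 mulr_ge0// le_max lexx.
Qed.

(** Written for 1 - e^(-t h), the growth of e^(-t h) by the factor 1 + q reads (1 + q) g - q. It is
    [supermartingale_step] averaged over the samples. *)
Lemma potential_drift (R : realType) (nx nr : nat) (L : while_loop R nx nr)
    (h : config nx -> R) (delta zeta t : R) (v : valuation nx) :
  0 < delta -> 0 < t -> t * zeta <= 2 ->
  (\esum_(u in [set: valuation nr]) (joint L u)%:E = 1)%E ->
  delta <= h (loc_in, v) ->
  (forall u, supp_joint L u -> delta <= h (loc_in, body L v u)) ->
  (\esum_(u in [set: valuation nr]) (joint L u * h (loc_in, body L v u))%:E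
     <= (h (loc_in, v))%:E)%E ->
  (delta%:E <=
     \esum_(u in [set: valuation nr]) (joint L u * `|increment L h v u|)%:E)%E ->
  (forall u, supp_joint L u -> `|increment L h v u| <= zeta) ->
  (\esum_(u in [set: valuation nr]) (joint L u * potential h t (body L v u))%:E
     <= ((1 + t ^+ 2 * delta ^+ 2 / 4) * potential h t v
         - t ^+ 2 * delta ^+ 2 / 4)%:E)%E.
Proof.
move=> d0 t0 tz mass hv hb sup var bnd.
set g := potential h t.
have J0 := joint_ge0 L.
set x := h (loc_in, v) in hv sup *.
pose y u := h (loc_in, body L v u).
have x0 : 0 < x by exact: lt_le_trans hv.
have gv : g v = 1 - expR (- (t * x)) by rewrite /g /potential max_r// ltW.
set E := expR (- (t * x)) in gv.
have E0 : 0 < E by exact: expR_gt0.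
have g0 w : 0 <= g w by exact/potential_ge0/ltW.
(* Off the support [h] may be negative, but the weight there is zero. *)
have Jy0 u : 0 <= joint L u * y u.
  have := J0 u; rewrite le_eqVlt => /predU1P[<-|Ju]; first by rewrite mul0r.
  by rewrite mulr_ge0// (le_trans (ltW d0))// hb.
set S1 := (X in (X <= _)%E); set S2 := (X in (_ <= X)%E) in var.
set S3 := (X in (X <= _)%E) in sup.
pose a := E * (t ^+ 2 * delta / 2); pose b := E * (t * x).
pose c := E * t; pose e := E * (t ^+ 2 * delta ^+ 2 / 4).
have a0 : 0 <= a.
  by rewrite mulr_ge0 ?(ltW E0)// divr_ge0// mulr_ge0 ?sqr_ge0 ?ltW.
have b0 : 0 <= b by rewrite !mulr_ge0 ?ltW.
have c0 : 0 <= c by rewrite !mulr_ge0 ?ltW.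
have e0 : 0 <= e by rewrite mulr_ge0 ?(ltW E0)// divr_ge0// mulr_ge0 ?sqr_ge0.
have E1 : 0 <= 1 - E by rewrite -gv.
have massZ k : 0 <= k ->
    (\esum_(u in [set: valuation nr]) (k%:E * (joint L u)%:E) = k%:E)%E.
  by move=> k0; rewrite esumZl ?mass ?mule1// => u; rewrite lee_fin.
(* Each constant is spread out as a sum against [joint], of total mass 1; the comparison is then
   termwise and free of subtraction in the extended reals. *)
have key : (S1 + (a%:E * S2 + b%:E) <= (1 - E)%:E + (c%:E * S3 + e%:E))%E.
  rewrite -[in leLHS](massZ b)// -[in leRHS](massZ (1 - E))//.
  rewrite -[in leRHS](massZ e)// /S1 /S2 /S3.
  rewrite -esumZl//; last by move=> u; rewrite lee_fin mulr_ge0.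
  rewrite -esumZl//.
  have terms_ge0 u : [/\ 0 <= a * (joint L u * `|increment L h v u|),
      0 <= b * joint L u, 0 <= c * (joint L u * y u), 0 <= e * joint L u
      & 0 <= (1 - E) * joint L u].
    by split; apply: mulr_ge0 => //; exact: mulr_ge0.
  rewrite -!esumD; do ?[by move=> u _; rewrite -?EFinM -?EFinD lee_fin;
    have [] := terms_ge0 u; rewrite /y; lra]; last first.
    by move=> u _; rewrite lee_fin mulr_ge0.
  apply: le_esum => u _; rewrite -!EFinM -!EFinD lee_fin.
  have := J0 u; rewrite le_eqVlt => /predU1P[<-|Ju].
    by rewrite !(mul0r, mulr0, addr0).
  have y0 : 0 < y u by rewrite (lt_le_trans d0)// hb.
  have := supermartingale_step delta t0 tz (bnd u Ju).
  rewrite /= -/x -/E -/(y u) => /(ler_wpM2l (J0 u)).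
  rewrite /g /potential max_r ?(ltW y0)// /a /b /c /e /increment -/x -/(y u).
  move: (expR _) => z; lra.
have var' : (a%:E * delta%:E <= a%:E * S2)%E by rewrite lee_wpmul2l// lee_fin.
have sup' : (c%:E * S3 <= c%:E * x%:E)%E by rewrite lee_wpmul2l// lee_fin.
(* Here [c * x] equals [b], and [a * delta - e] equals E t^2 delta^2 / 4, which is the required
   gain. *)
have key2 : (S1 + (a%:E * delta%:E + b%:E) <= (1 - E)%:E + (c%:E * x%:E + e%:E))%E.
  apply: le_trans (le_trans key _); first by rewrite leeD2l// leeD2r.
  by rewrite leeD2l// leeD2r.
have S1ge0 : (0 <= S1)%E by apply: esum_ge0 => u _; rewrite lee_fin mulr_ge0.
(* The finite right-hand side excludes an infinite [S1]. *)
clear key; move: key2; case: S1 S1ge0 => [s|//|//] _; last first.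
rewrite -!EFinM -!EFinD !lee_fin gv /a /b /c /e; lra.
Qed.

(** * Cylinder events and survival events *)

Definition agree_upto (nx : nat) (Omega : Type) (Z : nat -> Omega -> config nx)
    (c : nat -> config nx) (j : nat) : set Omega :=
  [set w | forall i, (i <= j)%N -> Z i w = c i].

Definition inside_upto (nx : nat) (Omega : Type) (Z : nat -> Omega -> config nx)
    (k : nat) : set Omega :=
  [set w | forall i, (i <= k)%N -> (Z i w).1 = loc_in].

(** Only indices up to [j.+1] are inspected; the constant tail beyond is padding. *)
Definition extend_by (nx : nat) (c : nat -> config nx) (j : nat) (e : config nx)
    (i : nat) : config nx :=
  if (i <= j)%N then c i else e.

Lemma measurable_agree_upto (nx : nat) (d : measure_display)
    (Omega : measurableType d) (Z : nat -> Omega -> config nx)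
    (c : nat -> config nx) (j : nat) :
  (forall k c, measurable [set w | Z k w = c]) -> measurable (agree_upto Z c j).
Proof.
move=> mZ; rewrite (_ : agree_upto Z c j =
    \bigcap_(i in [set i | (i <= j)%N]) [set w | Z i w = c i])//.
by apply: bigcap_measurable => //; exists 0%N.
Qed.

Lemma measurable_inside_upto (nx : nat) (d : measure_display)
    (Omega : measurableType d) (Z : nat -> Omega -> config nx) (k : nat) :
  (forall k c, measurable [set w | Z k w = c]) -> measurable (inside_upto Z k).
Proof.
move=> mZ; rewrite (_ : inside_upto Z k =
    \bigcap_(i in [set i | (i <= k)%N]) [set w | (Z i w).1 = loc_in])//.
apply: bigcap_measurable; first by exists 0%N.
move=> i _.
rewrite (_ : mkset _ = \bigcup_v [set w | Z i w = (loc_in, v)]).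
  by apply: countable_bigcupT_measurable => [|v]; [exact: countableP|exact: mZ].
apply/seteqP; split => w /=; last by move=> [v _ ->].
by case E : (Z i w) => [l v] /= lin; exists v; rewrite /= ?E ?lin.
Qed.

Lemma agree_upto_extend (nx : nat) (Omega : Type) (Z : nat -> Omega -> config nx)
    (c : nat -> config nx) (j : nat) (e : config nx) :
  agree_upto Z (extend_by c j e) j.+1 =
  agree_upto Z c j `&` [set w | Z j.+1 w = e].
Proof.
apply/seteqP; split => w.
  move=> H; split; last by have := H _ (leqnn _); rewrite /extend_by ltnn.
  by move=> i ij; have := H i (leqW ij); rewrite /extend_by ij.
move=> [H Hv] i; rewrite /extend_by; case: (leqP i j) => [ij _|ji ij]; first exact: H.
by have -> : i = j.+1 by apply/eqP; rewrite eqn_leq ij.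
Qed.

(** * One-step conditioning and the survival estimate *)

Section Process.
Variables (R : realType) (nx nr : nat) (L : while_loop R nx nr).
Variables (v0 : valuation nx) (d : measure_display) (Omega : measurableType d).
Variables (P : probability Omega R) (Z : nat -> Omega -> config nx).
Hypothesis hZ : loop_process L P v0 Z.

Let mZ : forall k c, measurable [set w | Z k w = c].
Proof. by case: hZ. Qed.

(** The Markov property in product form, which also covers cylinders of probability zero. *)
Lemma prob_agree_upto_extend (c : nat -> config nx) (j : nat) (e : config nx) :
  c 0%N = (loc_in, v0) ->
  P (agree_upto Z (extend_by c j e) j.+1) =
  (P (agree_upto Z c j) * transition L (c j) e)%E.
Proof.
case: hZ => _ _ fdd c0.
rewrite /agree_upto !fdd// big_ord_recr /=; congr (_ * _)%E; last first.
  by rewrite /extend_by leqnn ltnn.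
apply: eq_bigr => i _.
by rewrite /extend_by (ltnW (ltn_ord i)) ltn_ord.
Qed.

(** Survival fixes the location at time [j.+1], so only the valuation there varies. The horizon is
    regrouped as [j.+1 + n] to suit induction on [n]. *)
Lemma inside_partition (c : nat -> config nx) (j n : nat) :
  agree_upto Z c j `&` inside_upto Z (j + n.+1) =
  \bigcup_v (agree_upto Z (extend_by c j (loc_in, v)) j.+1 `&` inside_upto Z (j.+1 + n)).
Proof.
rewrite -addSnnS; apply/seteqP; split => w.
  move=> [A B]; case E : (Z j.+1 w) => [l v].
  have := B j.+1; rewrite leq_addr E => /(_ isT) /= lin.
  by exists v => //; split=> //; rewrite agree_upto_extend; split=> //; rewrite -lin.
by move=> [v _]; rewrite agree_upto_extend => -[[A _] B].
Qed.

Lemma measure_inside_partition (c : nat -> config nx) (j n : nat) :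
  P (agree_upto Z c j `&` inside_upto Z (j + n.+1)) =
  \esum_(v in [set: valuation nx])
    P (agree_upto Z (extend_by c j (loc_in, v)) j.+1 `&` inside_upto Z (j.+1 + n)).
Proof.
rewrite inside_partition measure_bigcup_count//.
  by move=> v; apply: measurableI; [exact: measurable_agree_upto|
    exact: measurable_inside_upto].
move=> v v' _ _ [w []]; rewrite !agree_upto_extend => -[[_ /= ->] _] [[_ /=]].
by move=> [].
Qed.

(* Read off the first step of the process rather than from the product of the
   marginal sums. *)
Lemma sampling_mass :
  guard L v0 -> (\esum_(u in [set: valuation nr]) (joint L u)%:E = 1)%E.
Proof.
move=> gv0; case: (hZ) => _ init fdd.
pose c (i : nat) : config nx := (loc_in, v0).
have A0 : agree_upto Z c 0 = [set w | Z 0%N w = (loc_in, v0)].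
  apply/seteqP; split => w /=; first exact.
  by move=> H i; rewrite leqn0 => /eqP ->.
have mA0 : measurable (agree_upto Z c 0) by rewrite A0.
have mB : measurable (inside_upto Z 1) by exact: measurable_inside_upto.
have step e := prob_agree_upto_extend 0 e (erefl (c 0%N)).
have PA0 : P (agree_upto Z c 0) = 1%E by rewrite A0.
have mext e : measurable (agree_upto Z (extend_by c 0 e) 1).
  exact: measurable_agree_upto.
(* Since the guard holds at [v0], each of the countably many exits at time 1 has probability zero,
   so the whole mass stays inside. *)
have out0 : P (agree_upto Z c 0 `\` inside_upto Z 1) = 0%E.
  apply/eqP; rewrite eq_le measure_ge0 andbT.
  apply: (@le_trans _ _ (P (\bigcup_v agree_upto Z (extend_by c 0 (loc_out, v)) 1))).
    rewrite le_measure ?inE//; first exact: measurableD.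
      by apply: countable_bigcupT_measurable => //; exact: countableP.
    move=> w [A nB]; case E : (Z 1%N w) => [[] v]; last first.
      by exists v => //; rewrite agree_upto_extend.
    case: nB => -[_|[_|//]]; last by rewrite E.
    by rewrite A.
  rewrite measure_bigcup_count//; last first.
    move=> v v' _ _ [w []]; rewrite !agree_upto_extend => -[_ /= ->] [_ /=].
    by move=> [].
  rewrite esum1// => v _; apply: etrans (step _) _.
  by rewrite /= gv0 mule0.
have DI : P (agree_upto Z c 0) = (P (agree_upto Z c 0 `\` inside_upto Z 1) +
    P (agree_upto Z c 0 `&` inside_upto Z 1))%E by exact: measureDI.
have <- := PA0; rewrite DI out0 add0e.
have := measure_inside_partition c 0 0; rewrite add0n => ->.
(* The factor 1 is the constant function to which [esum_transition] is applied. *)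
transitivity (\esum_(v in [set: valuation nx])
    (transition L (loc_in, v0) (loc_in, v) * 1%:E))%E.
  by rewrite esum_transition//; apply: eq_esum => u _; rewrite mulr1.
apply: eq_esum => v _; rewrite mule1.
have := step (loc_in, v); rewrite PA0 mul1e => <-.
congr (P _).
apply/seteqP; split => w; last by case.
move=> A; split=> // i; rewrite leq_eqVlt => /predU1P[->|].
  by rewrite A.
by rewrite ltnS leqn0 => /eqP ->; rewrite A.
Qed.

(** No transition from (in, v) stays inside when the guard fails, and [n.+1] makes the event
    constrain time [j.+1]. *)
Lemma prob_inside_guardN (c : nat -> config nx) (j n : nat) (v : valuation nx) :
  c 0%N = (loc_in, v0) -> c j = (loc_in, v) -> ~~ guard L v ->
  P (agree_upto Z c j `&` inside_upto Z (j + n.+1)) = 0%E.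
Proof.
move=> c0 cj ngv; rewrite measure_inside_partition esum1// => v' _.
apply/eqP; rewrite eq_le measure_ge0 andbT.
apply: (@le_trans _ _ (P (agree_upto Z (extend_by c j (loc_in, v')) j.+1))).
  rewrite le_measure// ?inE; last exact: measurable_agree_upto.
  apply: measurableI; first exact: measurable_agree_upto.
  exact: measurable_inside_upto.
by rewrite prob_agree_upto_extend// cj /= (negbTE ngv) mule0.
Qed.

(** Induction on the number of remaining steps, uniformly in the history [c]: splitting on the next
    valuation lets the induction hypothesis be averaged, and the drift bounds that average. *)
Lemma survival_bound (g : valuation nx -> R) (q : R) :
  0 <= q -> (forall v, 0 <= g v) ->
  (forall v, guard L v ->
    (\esum_(u in [set: valuation nr]) (joint L u * g (body L v u))%:E
      <= ((1 + q) * g v - q)%:E)%E) ->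
  forall n j (c : nat -> config nx) v,
  c 0%N = (loc_in, v0) -> c j = (loc_in, v) ->
  (P (agree_upto Z c j `&` inside_upto Z (j + n)) * (1 - (1 + q) ^- n)%:E
     <= P (agree_upto Z c j) * (g v)%:E)%E.
Proof.
move=> q0 g0 dr; elim=> [|n IHn] j c v c0 cj.
  by rewrite expr0 invr1 subrr mule0 mule_ge0// lee_fin.
have mA c' k := measurable_agree_upto c' k mZ.
have mAI c' k k' : measurable (agree_upto Z c' k `&` inside_upto Z k').
  by apply: measurableI => //; exact: measurable_inside_upto.
have rn k : 0 <= 1 - (1 + q) ^- k.
  by rewrite subr_ge0 invf_le1 ?exprn_gt0 ?exprn_ege1//; lra.
have [gv|ngv] := boolP (guard L v); last first.
  by rewrite (prob_inside_guardN n c0 cj ngv) mul0e mule_ge0// lee_fin.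
have finP A : measurable A -> P A \is a fin_num by exact: fin_num_measure.
have PA := fineK (finP _ (mA c j)).
set p := fine _ in PA.
have p0 : 0 <= p by exact: fine_ge0.
have step : (P (agree_upto Z c j `&` inside_upto Z (j + n.+1)) *
    (1 - (1 + q) ^- n)%:E <= (p * ((1 + q) * g v - q))%:E)%E.
  rewrite EFinM; apply: (@le_trans _ _ (p%:E *
     \esum_(u in [set: valuation nr]) (joint L u * g (body L v u))%:E)%E); last first.
    by rewrite lee_wpmul2l ?lee_fin// dr.
  rewrite -esum_transition// -esumZl//; last first.
    by move=> v'; rewrite mule_ge0 ?transition_ge0 ?lee_fin.
  rewrite measure_inside_partition muleC -esumZl//.
  apply: le_esum => v' _; rewrite muleC.
  have := IHn j.+1 (extend_by c j (loc_in, v')) v'.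
  rewrite {1}/extend_by c0 {1}/extend_by ltnn => /(_ erefl erefl) /le_trans; apply.
  by rewrite prob_agree_upto_extend// cj PA muleA.
(* This absorbs the term [- q] of the drift: adding q b <= q p to [step] and dividing by 1 + q turns
   the exponent n into n + 1. *)
have le_p : (P (agree_upto Z c j `&` inside_upto Z (j + n.+1)) <= p%:E)%E.
  by rewrite PA le_measure// ?inE.
move: step le_p; rewrite -PA -(fineK (finP _ (mAI _ _ _))) -!EFinM !lee_fin.
move: (fine _) => b step le_b.
have q1 : 0 < 1 + q by lra.
rewrite -(ler_pM2l q1).
have -> : (1 + q) * (b * (1 - (1 + q) ^- n.+1)) = b * (1 - (1 + q) ^- n) + b * q.
  have : (1 + q) ^+ n != 0 by rewrite expf_neq0 ?gt_eqF.
  by rewrite exprS; move: ((1 + q) ^+ n) => z z0; field; rewrite z0 gt_eqF.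
nra.
Qed.

(** The initial configuration has probability 1, so survival may be restricted to the cylinder at
    time 0, the form that [survival_bound] handles. *)
Lemma prob_inside_init (n : nat) :
  P (inside_upto Z n) =
  P (agree_upto Z (fun=> (loc_in, v0)) 0 `&` inside_upto Z n).
Proof.
case: (hZ) => _ init _.
have A0 : agree_upto Z (fun=> (loc_in, v0)) 0 = [set w | Z 0%N w = (loc_in, v0)].
  apply/seteqP; split => w /=; first exact.
  by move=> H i; rewrite leqn0 => /eqP ->.
have mB : measurable (inside_upto Z n) by exact: measurable_inside_upto.
have mA : measurable [set w | Z 0%N w = (loc_in, v0)] by [].
rewrite A0 setIC.
have -> : P (inside_upto Z n) =
    (P (inside_upto Z n `\` [set w | Z 0%N w = (loc_in, v0)]) +
     P (inside_upto Z n `&` [set w | Z 0%N w = (loc_in, v0)]))%E.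
  exact: measureDI.
rewrite [X in (X + _)%E](_ : _ = 0%E) ?add0e//.
apply/eqP; rewrite eq_le measure_ge0 andbT.
apply: (@le_trans _ _ (P (~` [set w | Z 0%N w = (loc_in, v0)]))).
  by rewrite le_measure ?inE//; [exact: measurableD|exact: measurableC].
by rewrite probability_setC// init subee.
Qed.

Lemma prob_inside_bound (h : config nx -> R) : dbsm_map L h ->
  exists2 C : R, 0 < C &
    forall n, (0 < n)%N -> (P (inside_upto Z n) <= (C / Num.sqrt n%:R)%:E)%E.
Proof.
move=> [delta [zeta [d0 z0 [_ D2 D3 [D4 _]]]]].
pose c (i : nat) : config nx := (loc_in, v0).
have [gv|ngv] := boolP (guard L v0); last first.
  (* Survival to a positive time has probability zero here, so any constant serves. *)
  exists 1 => // -[//|n] _.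
  have := @prob_inside_guardN c 0 n v0 erefl erefl ngv.
  rewrite prob_inside_init add0n => ->.
  by rewrite lee_fin divr_ge0 ?sqrtr_ge0.
have x0 : 0 < h (loc_in, v0) by rewrite (lt_le_trans d0)//; exact: (D2 _ gv).1.
set x := h _ in x0.
pose a := delta ^+ 2 / zeta ^+ 2.
have a0 : 0 < a by rewrite divr_gt0// exprn_gt0.
(* The coefficient of 1 / sqrt n in t x (1 + a) / a, for the [t] chosen below. *)
exists (2 * x * (1 + a) / (zeta * a)).
  by rewrite divr_gt0 ?(mulr_gt0 z0 a0)// mulr_gt0 ?addr_gt0// mulr_gt0.
move=> n n0; set s := Num.sqrt n%:R.
have nR : 0 < n%:R :> R by rewrite ltr0n.
have s0 : 0 < s by rewrite sqrtr_gt0.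
have sE : s ^+ 2 = n%:R by rewrite sqr_sqrtr// ltW.
pose t := 2 / (zeta * s).
have t0 : 0 < t by rewrite divr_gt0// mulr_gt0.
have tz : t * zeta <= 2.
  have -> : t * zeta = 2 / s by rewrite /t; field; rewrite !gt_eqF.
  rewrite ler_pdivrMr// ler_peMr//.
  by rewrite /s -[X in X <= _]sqrtr1 ler_wsqrtr// ler1n.
pose q := t ^+ 2 * delta ^+ 2 / 4.
have q0 : 0 <= q by rewrite divr_ge0// mulr_ge0 ?sqr_ge0.
(* The choice of [t] makes q = a / n, so that the total growth does not depend on the horizon. *)
have nq : q *+ n = a.
  rewrite -mulr_natr -sE /q /t /a; field; by rewrite !gt_eqF.
have dr v : guard L v ->
    (\esum_(u in [set: valuation nr]) (joint L u * potential h t (body L v u))%:E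
      <= ((1 + q) * potential h t v - q)%:E)%E.
  move=> gv'; have [? ?] := D2 _ gv'; have [? ?] := D3 _ gv'.
  apply: (@potential_drift _ _ _ _ _ delta zeta) => //; first exact: sampling_mass.
  by move=> u Ju; exact: D4.
have g0 v : 0 <= potential h t v by exact/potential_ge0/ltW.
have := survival_bound q0 g0 dr n (erefl (c 0%N)) (erefl (c 0%N)).
rewrite add0n -prob_inside_init.
have mI : measurable (inside_upto Z n) by exact: measurable_inside_upto.
have finI : P (inside_upto Z n) \is a fin_num by exact: fin_num_measure.
have le1 : (P (agree_upto Z c 0) * (potential h t v0)%:E <= (potential h t v0)%:E)%E.
  rewrite -[leRHS]mul1e lee_wpmul2r ?lee_fin// probability_le1//.
  exact: measurable_agree_upto.
move=> /le_trans /(_ le1).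
rewrite -(fineK finI) -EFinM !lee_fin.
have p0 : 0 <= fine (P (inside_upto Z n)) by rewrite fine_ge0.
move: (fine _) p0 => p p0 bnd.
have gx : potential h t v0 <= t * x.
  rewrite /potential max_r ?(ltW x0)//.
  by have := expR_ge1Dx (- (t * x)); rewrite -/x; lra.
(* By Bernoulli (1 + q)^n >= 1 + a, which keeps this factor away from 0 uniformly in [n]. *)
have rn : a / (1 + a) <= 1 - (1 + q) ^- n.
  have B : 1 + a <= (1 + q) ^+ n by rewrite -nq bernoulli_ge.
  have -> : a / (1 + a) = 1 - (1 + a)^-1 by field; rewrite gt_eqF// addr_gt0.
  by rewrite lerD2l lerN2 lef_pV2 ?posrE ?addr_gt0// exprn_gt0// ltr_wpDr.
have : p * (a / (1 + a)) <= t * x.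
  by apply: le_trans (le_trans bnd gx); rewrite ler_wpM2l.
rewrite -ler_pdivlMr; last by rewrite divr_gt0// addr_gt0.
move=> /le_trans; apply.
rewrite le_eqVlt; apply/orP; left; apply/eqP.
rewrite /t -/s; field; rewrite !gt_eqF// addr_gt0//.
Qed.

End Process.

(** * Events of the termination time, and the conclusion *)

(** Exit times are integers, so T >= k + 1 excludes exactly the exits at times 0 to k; a run that
    never exits has infimum [+oo] and lies in both sets. *)
Lemma termination_time_gt (R : realType) (nx : nat) (Omega : Type)
    (Z : nat -> Omega -> config nx) (k : nat) :
  [set w | (k.+1%:R%:E <= termination_time R Z w)%E] = inside_upto Z k.
Proof.
apply/seteqP; split => w /=.
  move=> /ereal_infP H i ik; case E : (Z i w).1 => //.
  have := H i%:R%:E; rewrite lee_fin ler_nat ltnNge ik.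
  by move=> absurd; exfalso; apply: notF; apply: absurd; exists i.
move=> H; apply/ereal_infP => _ [m /= out <-].
rewrite lee_fin ler_nat ltnNge; apply/negP => /H.
by rewrite out.
Qed.

Lemma termination_time_lty (R : realType) (nx : nat) (Omega : Type)
    (Z : nat -> Omega -> config nx) :
  [set w | (termination_time R Z w < +oo)%E] = ~` \bigcap_k inside_upto Z k.
Proof.
apply/seteqP; split => w /=.
  move=> fin inw; move: fin; rewrite ltNge => /negP; apply.
  apply/ereal_infP => _ [m /= out <-].
  by have := inw m I m (leqnn m); rewrite out.
apply: contra_notP => /negP; rewrite -leNgt => infw k _ i _.
case E : (Z i w).1 => //.
have : (termination_time R Z w <= i%:R%:E)%E by apply: ereal_inf_lbound; exists i.
by move=> /(le_trans infw).
Qed.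

Theorem theorem6 (R : realType) (nx nr : nat) (L : while_loop R nx nr)
    (hL : exists h : config nx -> R, dbsm_map L h)
    (v0 : valuation nx)
    (d : measure_display) (Omega : measurableType d) (P : probability Omega R)
    (Z : nat -> Omega -> config nx) (hZ : loop_process L P v0 Z) :
  P [set w | (termination_time R Z w < +oo)%E] = 1%E /\
  (fun k : nat => fine (P [set w | (k%:R%:E <= termination_time R Z w)%E]) : R^o)
    =O_\oo (fun k : nat => (Num.sqrt (k%:R : R))^-1 : R^o).
Proof.
have [h /(prob_inside_bound hZ)[C C0 bound]] := hL.
have mI k : measurable (inside_upto Z k).
  by apply: measurable_inside_upto; case: hZ.
have finP A : measurable A -> P A \is a fin_num by exact: fin_num_measure.
split.
  have mN : measurable (\bigcap_k inside_upto Z k) by exact: bigcap_measurableType.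
  rewrite termination_time_lty probability_setC//.
  rewrite -(fineK (finP _ mN)).
  set p := fine _.
  have p0 : 0 <= p by rewrite fine_ge0.
  suff -> : p = 0 by rewrite sube0.
  apply/eqP; rewrite eq_le p0 andbT leNgt; apply/negP => p_gt0.
  (* Large enough that C / sqrt n < p, although the intersection lies in [inside_upto Z n]. *)
  pose n := (Num.truncn ((C / p) ^+ 2)).+1.
  have ln : C / p < Num.sqrt n%:R.
    rewrite -(@ltr_pXn2r _ 2) ?nnegrE ?sqrtr_ge0 ?divr_ge0 ?ltW//.
    by rewrite sqr_sqrtr ?ler0n// truncnS_gt.
  have s0 : 0 < Num.sqrt n%:R :> R by rewrite sqrtr_gt0 ltr0n.
  have : p <= C / Num.sqrt n%:R.
    rewrite -lee_fin fineK ?finP//; apply: le_trans (bound n isT).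
    by rewrite le_measure ?inE//; exact: bigcap_inf.
  by rewrite ler_pdivlMr// leNgt mulrC -ltr_pdivrMr// ln.
(* The factor 2 pays for the index shift: T >= n + 1 is bounded by C / sqrt n, and sqrt (n + 1) <= 2
   sqrt n once n >= 1, hence the threshold 2 below. *)
apply/eqO_exP; exists (C * 2); first by rewrite mulr_gt0.
exists 2%N => // -[//|n] /=; rewrite ltnS => n0.
rewrite termination_time_gt.
have s0 m : (0 < m)%N -> 0 < Num.sqrt m%:R :> R by move=> ?; rewrite sqrtr_gt0 ltr0n.
have B : fine (P (inside_upto Z n)) <= C / Num.sqrt n%:R.
  by rewrite -lee_fin fineK ?finP ?bound.
rewrite ger0_norm ?fine_ge0// ger0_norm ?invr_ge0 ?sqrtr_ge0//.
apply: le_trans B _; rewrite -mulrA ler_pM2l//.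
rewrite ler_pdivlMr ?s0// mulrC ler_pdivrMr ?s0//.
rewrite -(@ler_pXn2r _ 2) ?nnegrE ?mulr_ge0 ?sqrtr_ge0// exprMn !sqr_sqrtr ?ler0n//.
by rewrite -natrX -natrM ler_nat (mulSn 3) -addn1 leq_add2l muln_gt0.
Qed.
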